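(* Let $k_0\ge 3$ be an integer and $\lambda>0$. Consider the random walk on the growing complete graph with parameters $k_0$ and $\lambda$ (defined in the context), and for an integer $T\ge 1$ let $N_T$ be the number of vertices visited at least once by the walker up to time $T$. Write $\mathcal{H}(n)=\sum_{i=1}^n \frac1i$. Then: (i) For every integer $T\ge 1$, $$\mathbb{E}[N_T]=(k_0+T-1)-e^{-\lambda \mathcal{H}(k_0+T-2)}\Big((k_0-1)e^{\lambda \mathcal{H}(k_0-2)}+\sum_{j=k_0+1}^{k_0+T-1}e^{\lambda \mathcal{H}(j-2)}\Big).$$ (ii) As $T\to\infty$, $\dfrac{\mathbb{E}[N_T]}{T}\to \dfrac{\lambda}{1+\lambda}$.
   Context: Model (random walk on the growing complete graph). At time $0$ there are $k_0\ge 3$ vertices $v_1,\dots,v_{k_0}$ forming a complete graph, and a walker sits at one of these vertices (fixed). For each $t\in\{1,2,\dots\}$, a new vertex $v_{k_0+t}$ is created at time $t$ and joined to all present vertices; thus during the time interval $[t-1,t)$ the graph is the complete graph on $v_1,\dots,v_{k_0+t-1}$. The walker moves at random times: the times between successive moves (and up to the first move) are i.i.d. exponential with mean $1/\lambda$, so the move times form a Poisson process of rate $\lambda$; in particular the numbers $M_t$ of moves in $[t-1,t)$, $t\ge1$, are independent Poisson random variables with parameter $\lambda$. At each move the walker jumps to a vertex chosen uniformly at random among the vertices present at that time other than her current vertex, independently of the move times and of the past given her current position. The starting vertex counts as visited. $N_T$ counts the vertices visited during the time from $0$ to $T$. An empty sum equals $0$. *)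

(* Defs.v *)
From HB Require Import structures.
From mathcomp Require Import all_boot all_order all_algebra.
From mathcomp Require Import finmap.
From mathcomp Require Import all_classical all_reals all_analysis.

Set Implicit Arguments.
Unset Strict Implicit.
Unset Printing Implicit Defensive.

Import Order.TTheory GRing.Theory Num.Theory.
Import numFieldNormedType.Exports.

Local Open Scope classical_set_scope.
Local Open Scope ring_scope.

(* The vertex v_i is encoded by its label i : nat, with labels starting at 1.
   On the interval [t-1, t) the graph is complete on v_1, ..., v_(k0+t-1);
   there Num.truncn s = t - 1. *)
Definition present (R : realType) (k0 : nat) (s : R) : seq nat :=
  iota 1 (k0 + Num.truncn s).

Definition neighbours (R : realType) (k0 : nat) (s : R) (x : nat) : seq nat :=
  [seq y <- present k0 s | y != x].

Definition jump_prob (R : realType) (k0 : nat) (s : R) (x y : nat) : R :=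
  if y \in neighbours k0 s x then (size (neighbours k0 s x))%:R^-1 else 0.

Section walk.
Context (R : realType) (d : measure_display) (Omega : measurableType d)
  (P : probability Omega R).

Definition mutually_independent (Y : nat -> {RV P >-> R}) : Prop :=
  forall (J : {fset nat}) (B : nat -> set R),
    (forall i, measurable (B i)) ->
    P (\bigcap_(i in [set` J]) (Y i @^-1` B i)) =
    (\prod_(i <- J) P (Y i @^-1` B i))%E.

(* tau i is the waiting time between move i and move i.+1, so move n takes
   place at time [move_time tau n]; index 0 is the start, at time 0. *)
Definition move_time (tau : nat -> {RV P >-> R}) (n : nat) (w : Omega) : R :=
  \sum_(i < n) tau i w.

(* The sigma-algebra of all the waiting times (past and future) and of the
   positions X 0, ..., X n. *)
Definition history (tau : nat -> {RV P >-> R}) (X : nat -> {RV P >-> nat})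
    (n : nat) : set (set Omega) :=
  <<s [set A | exists i (B : set R), measurable B /\ A = tau i @^-1` B] `|`
      [set A | exists j (x : nat), (j <= n)%N /\ A = X j @^-1` [set x]] >>.

(* X n is the position of the walker after n moves. The clause [walk_jump]
   says that, conditionally on [history tau X n], the law of X n.+1 is uniform
   on the vertices other than X n present at the time of move n.+1: this is
   the defining property of conditional probability given a sigma-algebra. *)
Record growing_walk (lambda : R) (k0 : nat) (tau : nat -> {RV P >-> R})
    (X : nat -> {RV P >-> nat}) : Prop := {
  walk_start : exists2 x0, x0 \in present k0 (0 : R) & forall w, X 0%N w = x0 ;
  walk_wait_exp : forall i (B : set R), measurable B ->
    distribution P (tau i) B = exponential_prob lambda B ;
  walk_wait_indep : mutually_independent tau ;
  walk_jump : forall n (A : set Omega) (y : nat), history tau X n A ->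
    P (A `&` X n.+1 @^-1` [set y]) =
    (\int[P]_(w in A)
       (jump_prob k0 (move_time tau n.+1 w) (X n w) y)%:E)%E
}.

Definition visited (tau : nat -> {RV P >-> R}) (X : nat -> {RV P >-> nat})
    (T : nat) (w : Omega) : set nat :=
  [set v | exists n, move_time tau n w <= T%:R /\ X n w = v].

(* Extended-real valued: infinitely many moves before time T are possible,
   although only with probability 0. *)
Definition num_visited (tau : nat -> {RV P >-> R}) (X : nat -> {RV P >-> nat})
    (T : nat) (w : Omega) : \bar R :=
  counting (visited tau X T w).

Definition mean_visited (tau : nat -> {RV P >-> R})
    (X : nat -> {RV P >-> nat}) (T : nat) : \bar R :=
  (\int[P]_w num_visited tau X T w)%E.

End walk.

Definition harmonic_number (R : realType) (n : nat) : R :=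
  \sum_(1 <= i < n.+1) i%:R^-1.

(* Main.v *)
Require Import Defs.
From HB Require Import structures.
From mathcomp Require Import all_boot all_order all_algebra.
From mathcomp Require Import finmap.
From mathcomp Require Import all_classical all_reals all_analysis.
From mathcomp Require Import measurable_realfun.
From mathcomp Require Import ring lra zify.

(* Fix a vertex v and let a_k be the chance that a move made during [k, k+1)
   hits v when the walker is elsewhere, i.e. 1/(k0 + k - 1) once v is present
   and 0 before. Conditionally on the move times S_1 < S_2 < ..., every move at
   a time s <= T misses v with probability phi(s) = 1 - a_(floor s), whatever
   the past positions are, so the probability that v is not visited by time T
   is the limit of E[phi(S_1) ... phi(S_n)] (times 0 if v is the start).
   Let G(s) be the exponential of -lambda times the integral of a_(floor u)
   over [s, T]. Then G is a fixed point of the one-step operator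
   s |-> E[phi(s + tau) G(s + tau)] with tau exponential, hence
   E[phi(S_1) ... phi(S_n) G(S_n)] = G(0) for every n; since P(S_n <= T) -> 0
   and G = 1 after T, the limit is G(0) = exp(-lambda (a_0 + ... + a_(T-1))).
   Summing over v gives (i). For (ii), the expected number U_T of unvisited
   vertices satisfies U_(T+1) = exp(-lambda/(k0 + T - 1)) (U_T + 1), so that
   U_T - (k0 + T - 1)/(1 + lambda) grows by O(1/T) at each step and is o(T). *)

Set Implicit Arguments.
Unset Strict Implicit.
Unset Printing Implicit Defensive.

Import Order.TTheory GRing.Theory Num.Theory.
Import numFieldNormedType.Exports.

Local Open Scope classical_set_scope.
Local Open Scope ring_scope.

(** * Change of measure by a density, also on a sub-sigma-algebra *)

Section density.
Import HBNNSimple.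

(** The identity for sets extends by linearity to simple functions, and monotone convergence along
    [nnsfun_approx] extends it to all nonnegative [f]. *)
Lemma ge0_integral_density d (T : measurableType d) (R : realType)
    (mu nu : {measure set T -> \bar R}) (g : T -> R) (f : T -> \bar R) :
    (forall x, 0 <= g x) -> measurable_fun [set: T] g ->
    (forall A, measurable A -> nu A = \int[mu]_(x in A) (g x)%:E)%E ->
    (forall x, 0 <= f x)%E -> measurable_fun [set: T] f ->
  (\int[nu]_x f x = \int[mu]_x (f x * (g x)%:E))%E.
Proof.
move=> g0 mg nuE f0 mf.
pose h := nnsfun_approx measurableT mf.
have h_cvg x : (h n x)%:E @[n --> \oo] --> f x by exact: cvg_nnsfun_approx.
have h_nd x : {homo (fun n => (h n x)%:E) : m n / (m <= n)%N >-> (m <= n)%E}.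
  by move=> m n mn; rewrite lee_fin; exact/lefP/nd_nnsfun_approx.
have simple n : (\int[nu]_x (h n x)%:E = \int[mu]_x ((h n x)%:E * (g x)%:E))%E.
  under eq_integral do rewrite fimfunE -fsumEFin//.
  rewrite ge0_integral_fsum//; last 2 first.
    - by move=> r; apply/measurable_EFinP; exact: measurable_funM.
    - by move=> m y Ey; exact: nnfun_muleindic_ge0.
  under [RHS]eq_integral => x _.
    rewrite fimfunE -fsumEFin// ge0_mule_fsuml; last first.
      by move=> r; exact: nnfun_muleindic_ge0.
    over.
  rewrite ge0_integral_fsum//; last 2 first.
    - move=> r; apply: emeasurable_funM; last exact/measurable_EFinP.
      by apply/measurable_EFinP; exact: measurable_funM.
    - by move=> r x _; rewrite mule_ge0 ?lee_fin//; exact: nnfun_muleindic_ge0.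
  apply: eq_fsbigr => r rhn.
  have r0 : 0 <= r by move: rhn; rewrite inE => -[t _ <-].
  under eq_integral do rewrite EFinM.
  rewrite integralZl_indic_nnsfun// integral_indic// setIT nuE//.
  have mA : measurable (h n @^-1` [set r]) by exact: measurable_sfunP.
  rewrite integral_mkcond epatch_indic -ge0_integralZl//; last 2 first.
    - by apply: emeasurable_funM; exact/measurable_EFinP.
    - by move=> x _; rewrite mule_ge0// lee_fin.
  by apply: eq_integral => x _; rewrite EFinM muleCA muleC.
transitivity (limn (fun n => \int[nu]_x (h n x)%:E)%E).
  rewrite -monotone_convergence//.
  - by apply: eq_integral => x _; apply/esym/cvg_lim.
  - by move=> n; exact/measurable_EFinP.
  - by move=> n x _; rewrite lee_fin.
under eq_fun do rewrite simple.
rewrite -monotone_convergence//.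
- apply: eq_integral => x _; apply/cvg_lim => //.
  exact: cvgeZr.
- by move=> n; apply: emeasurable_funM; exact/measurable_EFinP.
- by move=> n x _; rewrite mule_ge0// lee_fin.
- by move=> x _ m n mn; rewrite lee_wpmul2r ?lee_fin//; exact: h_nd.
Qed.

End density.

(** Read [g] as the conditional probability of [D] given the sigma-algebra generated by [G]: its
    defining property, known for events, is extended to measurable test functions. Both [mu] and its
    restriction to [D] are pushed forward along the identity to the smaller sigma-algebra, where [g]
    is the density of the second with respect to the first. *)
Lemma ge0_integral_density_sub d (T : measurableType d) (R : realType)
    (mu : {measure set T -> \bar R}) (G : set (set T)) (D : set T)
    (g : g_sigma_algebraType G -> R) (f : g_sigma_algebraType G -> \bar R) :
    G `<=` measurable -> measurable D ->
    (forall x, 0 <= g x) -> measurable_fun [set: _] g ->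
    (forall A, <<s G >> A -> mu (A `&` D) = \int[mu]_(x in A) (g x)%:E)%E ->
    (forall x, 0 <= f x)%E -> measurable_fun [set: _] f ->
  (\int[mu]_x (f x * (\1_D x)%:E) = \int[mu]_x (f x * (g x)%:E))%E.
Proof.
move=> mG mD g0 mg muE f0 mf.
have sGm : <<s G>> `<=` measurable.
  by apply: smallest_sub => //; exact: sigma_algebra_measurable.
have mid : measurable_fun [set: T] (idfun : T -> g_sigma_algebraType G).
  by move=> _ Y mY; rewrite setTI preimage_id; exact: sGm.
have mfT : measurable_fun [set: T] (f : T -> \bar R) by exact: (measurableT_comp mf mid).
have mgT : measurable_fun [set: T] (g : T -> R) by exact: (measurableT_comp mg mid).
pose push (m : {measure set T -> \bar R}) :=
  measure_function_pushforward__canonical__measure_function_Measure m mid.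
have pushE (m : {measure set T -> \bar R}) (h : T -> \bar R) (A : set T) :
    measurable_fun [set: g_sigma_algebraType G] h -> (forall x, 0 <= h x)%E ->
    <<s G>> A ->
    (\int[push m]_(x in A) h x = \int[m]_(x in A) h x)%E.
  move=> mh h0 mA; rewrite (ge0_integral_pushforward mid)//.
  exact: measurable_funTS.
transitivity (\int[push (mrestr mu mD)]_x f x)%E.
  rewrite pushE//; last exact: (@measurableT _ (g_sigma_algebraType G)).
  rewrite (@ge0_integral_density _ _ _ mu (mrestr mu mD) \1_D f)// => A mA.
  by rewrite integral_indic// setIC.
rewrite (@ge0_integral_density _ (g_sigma_algebraType G) _ (push mu) _ g f)//.
- rewrite pushE//; last exact: (@measurableT _ (g_sigma_algebraType G)).
    by apply: emeasurable_funM => //; exact/measurable_EFinP.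
  by move=> x; rewrite mule_ge0// lee_fin.
- move=> A mA; rewrite pushE//; last by exact/measurable_EFinP.
  exact: muE.
Qed.

(** * Exponential integrals and measurability of truncation *)

Lemma integral_expR_affine (R : realType) (a b al be : R) : a <= b ->
  (\int[lebesgue_measure]_(x in `[a, b[) (- al * expR (al * x + be))%:E =
   (expR (al * a + be) - expR (al * b + be))%:E)%E.
Proof.
rewrite le_eqVlt => /predU1P[<-|ab].
  by rewrite set_itvco0// integral_set0 subrr.
have dF x : is_derive (x : R^o) 1 (fun x => - expR (al * x + be) : R^o)
    (- al * expR (al * x + be)).
  by apply: is_derive_eq; rewrite scaler1 addr0 mulNr mulrC.
have cE : continuous (fun x : R => expR (al * x + be)).
  move=> x; apply: (@continuous_comp _ _ _ (fun x => al * x + be) expR).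
    by apply: cvgD; [exact: mulrl_continuous|exact: cvg_cst].
  exact: continuous_expR.
have cf : continuous (fun x : R => - al * expR (al * x + be)).
  by move=> x; apply: cvgM; [exact: cvg_cst|exact: cE].
rewrite integral_itv_bndo_bndc; last first.
  apply/measurable_EFinP; apply: measurable_funTS.
  exact: continuous_measurable_fun.
rewrite (@continuous_FTC2 _ _ (fun x => - expR (al * x + be)))//.
- by rewrite -EFinB opprK addrC.
- exact: continuous_subspaceT.
- split; first by move=> x _; have [] := dF x.
  + by apply: cvgN; apply/cvg_at_right_filter; exact: cE.
  + by apply: cvgN; apply/cvg_at_left_filter; exact: cE.
- by move=> x _; rewrite derive1E; have [_ ->] := dF x.
Qed.

Lemma integral_expR_tail (R : realType) (lambda a : R) : 0 < lambda ->
  (\int[lebesgue_measure]_(x in `[a, +oo[) (lambda * expR (- lambda * x))%:E =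
   (expR (- lambda * a))%:E)%E.
Proof.
move=> lambda_gt0.
have dF x : is_derive (x : R^o) 1 (fun x => - expR (- lambda * x) : R^o)
    (lambda * expR (- lambda * x)).
  by apply: is_derive_eq; rewrite scaler1 mulrN opprK mulrC.
have cE : continuous (fun x : R => expR (- lambda * x)).
  move=> x; apply: (@continuous_comp _ _ _ ( *%R (- lambda)) expR).
    exact: mulrl_continuous.
  exact: continuous_expR.
rewrite (@ge0_continuous_FTC2y _ _ (fun x => - expR (- lambda * x)) _ 0)//.
- by rewrite sub0e EFinN oppeK.
- by move=> x _; rewrite mulr_ge0 ?expR_ge0// ltW.
- apply: continuous_subspaceT => x.
  by apply: cvgM; [exact: cvg_cst|exact: cE].
- rewrite -oppr0; apply: cvgN.
  rewrite (_ : (fun x => expR (- lambda * x)) =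
               (fun z => expR (- z)) \o (fun z => lambda * z)); last first.
    by apply: eq_fun => x; rewrite mulNr.
  apply: (@cvg_comp _ _ _ _ _ _ (pinfty_nbhs R)); last exact: cvgr_expR.
  exact: gt0_cvgMry.
- by apply: cvgN; apply/cvg_at_right_filter; exact: cE.
- by move=> x _; rewrite derive1E; have [_ ->] := dF x.
Qed.

Lemma measurable_truncn (R : realType) :
  measurable_fun [set: R] (fun s : R => Num.truncn s).
Proof.
move=> _ Y _; rewrite setTI.
have mtr : measurable_fun [set: R] (fun s => (Num.truncn s)%:R : R).
  by apply: nondecreasing_measurable => // x y xy; rewrite ler_nat le_truncn.
rewrite (_ : _ @^-1` Y =
    \bigcup_(n in Y) (fun s => (Num.truncn s)%:R : R) @^-1` [set n%:R]).
  apply: bigcup_measurable => n _.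
  by rewrite -[X in measurable X]setTI; exact: mtr.
apply/seteqP; split=> [s Ys|s [n Yn /eqP]] /=; first by exists (Num.truncn s).
by rewrite eqr_nat => /eqP ->.
Qed.

(** * Thinned exponential waiting times *)

Section survival.
Context {R : realType}.
Variables (lambda : R) (a : nat -> R) (T : nat).

(* [a k] is the probability that a move during [k, k+1) hits the given vertex. *)
Definition thinning (s : R) : R :=
  if s <= T%:R then 1 - a (Num.truncn s) else 1.

(* The minimum is the length of [k, k+1) after time [s], so the sum is the
   integral of [a (truncn u)] over [s <= u <= T]. *)
Definition survival (s : R) : R :=
  expR (- (lambda *
    \sum_(0 <= k < T) a k * Num.min 1 (Num.max 0 (k.+1%:R - s)))).

Lemma measurable_thinning : measurable_fun [set: R] thinning.
Proof.
apply: measurable_fun_ifT => //; first exact: measurable_fun_ler.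
by apply: measurable_funB => //; exact: (measurableT_comp _ (@measurable_truncn R)).
Qed.

Lemma measurable_survival : measurable_fun [set: R] survival.
Proof.
apply: measurableT_comp => //; apply: measurableT_comp => //.
apply: measurable_funM => //; apply: measurable_sum => k.
apply: measurable_funM => //; apply: measurable_minr => //.
by apply: measurable_maxr => //; exact: measurable_funB.
Qed.

Lemma survival0 : survival 0 = expR (- (lambda * \sum_(0 <= k < T) a k)).
Proof.
congr (expR (- (_ * _))); apply: eq_bigr => k _.
by rewrite subr0 (max_idPr _)// (min_idPl _) ?mulr1 ?ler1n.
Qed.

Lemma survival_end (s : R) : T%:R <= s -> survival s = 1.
Proof.
move=> Ts; rewrite /survival big_nat big1 ?mulr0 ?oppr0 ?expR0// => k /= kT.
rewrite (max_idPl _) ?(min_idPr _) ?mulr0//.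
by rewrite subr_le0 (le_trans _ Ts)// ler_nat.
Qed.

(** On a unit interval the terms before [m] vanish, term [m] is affine in [s] and the later ones are
    full, so [survival] is the exponential of an affine function. Both endpoints are included so
    that the values on adjacent intervals can be matched. *)
Lemma survivalE (m : nat) (s : R) : (m < T)%N -> m%:R <= s <= m.+1%:R ->
  survival s = expR (- (lambda *
    (a m * (m.+1%:R - s) + \sum_(m.+1 <= k < T) a k))).
Proof.
move=> mT /andP[ms sm]; congr (expR (- (_ * _))).
rewrite (big_cat_nat _ (n := m)) ?(ltnW mT)//= big_nat big1 ?add0r.
  rewrite big_ltn//; congr (_ + _).
    by rewrite (max_idPr _) ?subr_ge0// (min_idPr _)// lerBlDr -natr1; lra.
  rewrite big_nat [RHS]big_nat; apply: eq_bigr => k /andP[mk _].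
  have mkR : m.+1%:R <= k%:R :> R by rewrite ler_nat.
  by rewrite (max_idPr _) ?(min_idPl _) ?mulr1 -?natr1//; lra.
move=> k /andP[_ km]; rewrite (max_idPl _) ?(min_idPr _) ?mulr0//.
by rewrite subr_le0 (le_trans _ ms)// ler_nat.
Qed.

Hypotheses (lambda_gt0 : 0 < lambda) (a01 : forall k, 0 <= a k <= 1).

Lemma thinning_ge0 s : 0 <= thinning s.
Proof.
by rewrite /thinning; case: ifPn => // _; rewrite subr_ge0; case/andP: (a01 (Num.truncn s)).
Qed.

Lemma thinning_le1 s : thinning s <= 1.
Proof.
by rewrite /thinning; case: ifPn => // _; rewrite gerBl; case/andP: (a01 (Num.truncn s)).
Qed.

Lemma survival_ge0 s : 0 <= survival s.
Proof. exact: expR_ge0. Qed.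

Lemma survival_le1 s : survival s <= 1.
Proof.
rewrite -expR0 ler_expR oppr_le0 mulr_ge0 ?(ltW lambda_gt0)//.
apply: sumr_ge0 => k _; rewrite mulr_ge0//; first by case/andP: (a01 k).
by rewrite le_min ler01 le_max lexx.
Qed.

Local Notation mu := (@lebesgue_measure R).
Local Notation integrand s :=
  (fun u => thinning (s + u) * survival (s + u) * (lambda * expR (- lambda * u))).

Let measurable_integrand s : measurable_fun [set: R] (integrand s).
Proof.
have mD : measurable_fun [set: R] (+%R s) by exact: measurable_funD.
apply: measurable_funM; first apply: measurable_funM.
- exact: (measurableT_comp measurable_thinning).
- exact: (measurableT_comp measurable_survival).
- by apply: measurable_funM => //; apply: measurableT_comp.
Qed.

Let integrand_ge0 s u : 0 <= integrand s u.
Proof.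
apply: mulr_ge0; first by apply: mulr_ge0; [exact: thinning_ge0|exact: expR_ge0].
by apply: mulr_ge0; [exact: ltW|exact: expR_ge0].
Qed.

(** Between integer times, the integrand is minus the derivative of
    [survival (s + u) * expR (- lambda * u)], so the pieces telescope. The maximum with 0 makes the
    pieces that lie before time [s] empty. *)
Let integral_thinning_survival_upto (s : R) (m : nat) : 0 <= s -> (m <= T)%N ->
  (\int[mu]_(u in `[0%R, (Num.max 0 (m%:R - s))%R[) (integrand s u)%:E =
   (survival s - survival (s + Num.max 0 (m%:R - s)) *
                 expR (- lambda * Num.max 0 (m%:R - s)))%:E)%E.
Proof.
move=> s0; elim: m => [|m IH] mT.
  rewrite (max_idPl _); last by lra.
  by rewrite set_itvco0// integral_set0 addr0 mulr0 expR0 mulr1 subrr.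
have b0 : 0 <= Num.max 0 (m%:R - s) by rewrite le_max lexx.
have bb : Num.max 0 (m%:R - s) <= Num.max 0 (m.+1%:R - s).
  by rewrite ge_max !le_max lexx/= lerD2r ler_nat leqnSn orbT.
set b := Num.max 0 (m%:R - s) in b0 bb IH *.
set b' := Num.max 0 (m.+1%:R - s) in bb *.
rewrite (@itv_bndbnd_setU _ _ _ (BLeft b))?bnd_simp//.
rewrite ge0_integral_setU//=; last 3 first.
  - apply/measurable_EFinP; apply: measurable_funTS.
    exact: measurable_integrand.
  - by move=> u _; rewrite lee_fin.
  - apply/disj_setPS => u/= [] /[!in_itv]/= /andP[_ ub] /andP[bu _].
    by move: (lt_le_trans ub bu); rewrite ltxx.
rewrite IH ?(ltnW mT)//.
suff -> : (\int[mu]_(u in `[b, b'[) (integrand s u)%:E =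
    (survival (s + b) * expR (- lambda * b) -
     survival (s + b') * expR (- lambda * b'))%:E)%E.
  by rewrite -EFinD; congr EFin; ring.
have [b'b|bb'] := leP b' b.
  have -> : b' = b by apply/eqP; rewrite eq_le b'b bb.
  by rewrite set_itvco0// integral_set0 subrr.
have b'E : b' = m.+1%:R - s.
  apply/max_idPr; rewrite leNgt; apply/negP => mS0.
  by move: bb'; rewrite /b' (max_idPl (ltW mS0)) ltNge b0.
have piece u : b <= u <= b' -> m%:R <= s + u <= m.+1%:R.
  move=> /andP[bu ub]; apply/andP; split; last by rewrite b'E in ub; lra.
  suff : m%:R - s <= b by lra.
  by rewrite le_max lexx orbT.
(* On this piece the primitive has exponent of slope [lambda * (a m - 1)]: [lambda * a m] comes from
   [survival] and [- lambda] from the exponential density. *)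
pose be := - (lambda * (a m * (m.+1%:R - s) + \sum_(m.+1 <= k < T) a k)).
have FE u : b <= u <= b' -> survival (s + u) * expR (- lambda * u) =
    expR ((lambda * (a m - 1)) * u + be).
  move=> ub; rewrite (survivalE mT (piece _ ub)) -expRD; congr expR.
  by rewrite /be; ring.
rewrite !FE ?lexx ?bb//.
rewrite -integral_expR_affine//.
apply: eq_integral => u; rewrite inE/= in_itv/= => /andP[bu ub].
have ubb : b <= u <= b' by rewrite bu ltW.
rewrite -FE//; congr EFin.
have /andP[mu' _] := piece _ ubb.
have um : s + u < m.+1%:R by rewrite b'E in ub; lra.
rewrite /thinning (@truncn_def _ _ m) ?mu'// ifT; first by ring.
by rewrite (le_trans (ltW um))// ler_nat.
Qed.

Variable nu : {measure set (measurableTypeR R) -> \bar R}.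
Hypothesis nu_exp : forall B, measurable B -> nu B = exponential_prob lambda B.

(** The fixed-point property of [survival]. The integral is cut where [s + u] reaches [T]: before,
    it telescopes; after, both [thinning] and [survival] equal 1 and only the exponential tail
    remains, which cancels the boundary term. *)
Lemma integral_thinning_survival (s : R) : 0 <= s ->
  (\int[nu]_u (thinning (s + u) * survival (s + u))%:E = (survival s)%:E)%E.
Proof.
move=> s0.
have mD : measurable_fun [set: R] (+%R s) by exact: measurable_funD.
rewrite (@ge0_integral_density _ _ _ mu nu (exponential_pdf lambda))//; last 4 first.
- by move=> x; apply: exponential_pdf_ge0; exact: ltW.
- exact: measurable_exponential_pdf.
- by move=> x; rewrite lee_fin mulr_ge0 ?thinning_ge0 ?survival_ge0.
- apply/measurable_EFinP/measurable_funM.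
  + exact: (measurableT_comp measurable_thinning).
  + exact: (measurableT_comp measurable_survival).
transitivity (\int[mu]_(u in `[0%R, +oo[) (integrand s u)%:E)%E.
  rewrite [RHS]integral_mkcond; apply: eq_integral => u _.
  rewrite patchE -EFinM /exponential_pdf patchE.
  by case: ifPn => //; rewrite mulr0.
have b0 : 0 <= Num.max 0 (T%:R - s) by rewrite le_max lexx.
set b := Num.max 0 (T%:R - s) in b0 *.
have Tb : T%:R <= s + b.
  suff : T%:R - s <= b by lra.
  by rewrite le_max lexx orbT.
rewrite (@itv_bndbnd_setU _ _ _ (BLeft b)) ?bnd_simp//.
rewrite ge0_integral_setU//=; last 3 first.
  - apply/measurable_EFinP; apply: measurable_funTS.
    exact: measurable_integrand.
  - by move=> u _; rewrite lee_fin.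
  - apply/disj_setPS => u/= [] /[!in_itv]/= /andP[_ ub] /andP[bu _].
    by move: (lt_le_trans ub bu); rewrite ltxx.
rewrite integral_thinning_survival_upto// -/b (survival_end Tb) mul1r.
suff -> : (\int[mu]_(u in `[b, +oo[) (integrand s u)%:E =
    (expR (- lambda * b))%:E)%E by rewrite -EFinD subrK.
(* The left endpoint is dropped because at time exactly [T] the value of [thinning] is still
   [1 - a T]. *)
rewrite -integral_expR_tail// -[LHS]integral_itv_obnd_cbnd; last first.
  apply/measurable_EFinP; apply: measurable_funTS.
  exact: measurable_integrand.
rewrite -[RHS]integral_itv_obnd_cbnd; last first.
  apply/measurable_EFinP; apply: measurable_funTS.
  by apply: measurable_funM => //; apply: measurableT_comp.
apply: eq_integral => u; rewrite inE/= in_itv/= andbT => bu.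
have Tu : T%:R < s + u by rewrite (le_lt_trans Tb)// ltrD2l.
by rewrite (survival_end (ltW Tu)) /thinning leNgt Tu/= !mul1r.
Qed.

End survival.

(** * Independence of the waiting times and law of the move times *)

Section waiting_times.
Context (R : realType) (d : measure_display) (Omega : measurableType d)
  (P : probability Omega R).
Variables (tau : nat -> {RV P >-> R}) (lambda : R).
Hypothesis lambda_gt0 : 0 < lambda.
Hypothesis tau_exp : forall i (B : set R), measurable B ->
  distribution P (tau i) B = exponential_prob lambda B.
Hypothesis tau_indep : mutually_independent tau.

Local Notation S := (move_time tau).

Lemma measurable_preimage_wait i (B : set R) :
  measurable B -> measurable (tau i @^-1` B).
Proof. by move=> mB; rewrite -[X in measurable X]setTI; exact: measurable_funP. Qed.

Lemma wait_ge0 : {ae P, forall w, forall i, 0 <= tau i w}.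
Proof.
apply: ae_foralln => i; exists (tau i @^-1` `]-oo, 0[%classic); split.
- exact: measurable_preimage_wait.
- rewrite [LHS](tau_exp i (measurable_itv _)).
  apply: integral0_eq => x; rewrite /= in_itv/= => x0.
  by rewrite lt0_exponential_pdf.
- by move=> w /= /negP; rewrite in_itv/= -ltNge.
Qed.

Lemma move_timeS n w : S n.+1 w = S n w + tau n w.
Proof. by rewrite /move_time big_ord_recr. Qed.

Lemma move_time0 w : S 0 w = 0.
Proof. by rewrite /move_time big_ord0. Qed.

(** These cylinder events form a pi-system that generates the sigma-algebra of the first [n] waiting
    times. *)
Definition past_waits (n : nat) : set (set Omega) :=
  [set A | exists2 B : nat -> set R, (forall i, measurable (B i)) &
             A = \bigcap_(i in `I_n) (tau i @^-1` B i)].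

Lemma past_waits_measurable n : past_waits n `<=` measurable.
Proof.
move=> _ [B mB ->]; apply: bigcap_measurableType => i _.
exact: measurable_preimage_wait.
Qed.

(** As functions of [E], the two sides are finite measures that agree on the pi-system
    [past_waits n], hence on the sigma-algebra it generates. *)
Lemma past_waits_indep n (E : set Omega) (C : set R) :
    measurable C -> <<s past_waits n>> E ->
  P (E `&` tau n @^-1` C) = (P E * P (tau n @^-1` C))%E.
Proof.
move=> mC; pose D := tau n @^-1` C.
have mD : measurable D by exact: measurable_preimage_wait.
have PD : P D \is a fin_num by exact: fin_num_measure.
pose r : {nonneg R} := NngNum (fine_ge0 (measure_ge0 P D)).
have rE A : mscale r P A = (P D * P A)%E by rewrite /mscale /= fineK.
suff : forall E, <<s past_waits n>> E -> mrestr P mD E = mscale r P E.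
  by move=> /[apply]; rewrite rE muleC.
apply: (g_sigma_algebra_measure_unique _ (@past_waits_measurable n) (fun=> setT)).
- by move=> _; exists (fun=> setT) => //; apply/esym/bigcapT.
- by rewrite bigcup_const//; exists 0%N.
- move=> _ _ [B mB ->] [B' mB' ->].
  exists (fun i => B i `&` B' i); first by move=> i; exact: measurableI.
  by rewrite -bigcapI.
- move=> _ [B mB ->].
  transitivity (mscale r P (\bigcap_(i in `I_n) tau i @^-1` B i)) => //.
  rewrite rE /mrestr.
  (* Intersecting a cylinder with the event on [tau n] gives a cylinder on [n.+1] coordinates, to
     which mutual independence applies. *)
  pose B' i := if i == n then C else B i.
  have mB' i : measurable (B' i) by rewrite /B'; case: ifPn.
  have B'E i : (i < n)%N -> B' i = B i by rewrite /B'; case: ltngtP.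
  have B'n : B' n = C by rewrite /B' eqxx.
  have II : `I_n.+1 = n |` `I_n.
    apply/seteqP; split=> i /=; last by case=> [->|/ltnW].
    by rewrite ltnS leq_eqVlt => /predU1P[->|]; [left|right].
  have nI : n \notin fset_set `I_n by rewrite in_fset_set // notin_setE /= ltnn.
  have := tau_indep (fset_set `I_n.+1) mB'.
  rewrite II fset_setU1// big_fsetU1//= set_fsetU1 fset_setK// bigcap_setU1 B'n.
  have := tau_indep (fset_set `I_n) mB'; rewrite fset_setK// => <-.
  have -> : \bigcap_(i in `I_n) tau i @^-1` B' i =
            \bigcap_(i in `I_n) tau i @^-1` B i.
    by apply: eq_bigcapr => i /= /B'E ->.
  by rewrite setIC.
- by move=> _; rewrite -ge0_fin_numE// fin_num_measure.
Qed.

(* [lebesgue_measure] lives on [measurableTypeR R], whose display differs from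
   that of [R]; [waitR] is [tau n] seen with values in the former. *)
Lemma measurable_waitR n :
  measurable_fun [set: Omega] (tau n : Omega -> measurableTypeR R).
Proof. by move=> _ B mB; rewrite setTI; exact: measurable_preimage_wait. Qed.

Definition waitR n : {mfun Omega >-> measurableTypeR R} :=
  HB.pack (tau n : Omega -> measurableTypeR R)
    (isMeasurableFun.Build _ _ _ _ _ (measurable_waitR n)).

(** By independence, the identity into the past sigma-algebra and [tau n] have the product of their
    laws as joint law, so Tonelli integrates out the last waiting time with the past frozen. *)
Lemma integral_past_wait n
    (f : (g_sigma_algebraType (past_waits n) * measurableTypeR R)%type -> \bar R) :
    measurable_fun [set: _] f -> (forall z, 0 <= f z)%E ->
  (\int[P]_w f (w, tau n w) =
   \int[P]_w \int[distribution P (waitR n)]_u f (w, u))%E.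
Proof.
move=> mf f0.
have mid : measurable_fun [set: Omega]
    (idfun : Omega -> g_sigma_algebraType (past_waits n)).
  move=> _ Y mY; rewrite setTI preimage_id.
  apply: (smallest_sub _ (@past_waits_measurable n)) mY.
  exact: sigma_algebra_measurable.
pose idX : {mfun Omega >-> g_sigma_algebraType (past_waits n)} :=
  HB.pack (idfun : Omega -> g_sigma_algebraType (past_waits n))
    (isMeasurableFun.Build _ _ _ _ _ mid).
have mpair : measurable_fun [set: Omega] (fun w => (idX w, waitR n w)).
  by apply: measurable_fun_pair; exact: measurable_funP.
pose pairX : {mfun Omega >->
    (g_sigma_algebraType (past_waits n) * measurableTypeR R)%type} :=
  HB.pack (fun w => (idX w, waitR n w))
    (isMeasurableFun.Build _ _ _ _ _ mpair).
transitivity (\int[distribution P pairX]_z f z)%E.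
  by rewrite ge0_integral_distribution.
transitivity (\int[(distribution P idX \x distribution P (waitR n))%E]_z f z)%E.
  apply: eq_measure_integral => A mA _; apply/esym.
  apply: product_measure_unique => // E C mE mC.
  exact: past_waits_indep.
rewrite fubini_tonelli1// ge0_integral_distribution//.
  exact: measurable_fun_fubini_tonelli_F.
by move=> w; exact: integral_ge0.
Qed.

Lemma measurable_past_wait n i : (i < n)%N ->
  measurable_fun [set: g_sigma_algebraType (past_waits n)] (tau i).
Proof.
move=> iltn _ B mB; rewrite setTI; apply: sub_sigma_algebra.
exists (fun j => if j == i then B else setT); first by move=> j; case: ifP.
apply/seteqP; split=> [w Bw j _|w /(_ i iltn)] /=; last by rewrite eqxx.
by case: eqP => // ->.
Qed.

Lemma measurable_past_move_time n i : (i <= n)%N ->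
  measurable_fun [set: g_sigma_algebraType (past_waits n)] (S i).
Proof.
move=> iltn; apply: measurable_sum => j; apply: measurable_past_wait.
exact: leq_trans (ltn_ord j) iltn.
Qed.

Lemma measurable_move_time n : measurable_fun [set: Omega] (S n).
Proof. by apply: measurable_sum => j; exact: measurable_funP. Qed.

Lemma integral_move_timeS n
    (Z : g_sigma_algebraType (past_waits n) -> R) (K : R -> R) :
    measurable_fun [set: _] Z -> measurable_fun [set: R] K ->
    (forall w, 0 <= Z w) -> (forall s, 0 <= K s) ->
  (\int[P]_w (Z w * K (S n.+1 w))%:E =
   \int[P]_w ((Z w)%:E *
     \int[distribution P (waitR n)]_u (K (S n w + u))%:E))%E.
Proof.
move=> mZ mK Z0 K0.
under eq_integral do rewrite move_timeS.
have mKS : measurable_fun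
    [set: (g_sigma_algebraType (past_waits n) * measurableTypeR R)%type]
    (fun z => K (S n z.1 + z.2)).
  apply: (measurableT_comp mK); apply: measurable_funD => //.
  by apply: measurableT_comp => //; exact: measurable_past_move_time.
rewrite (integral_past_wait (f := fun z => (Z z.1 * K (S n z.1 + z.2))%:E)).
- apply: eq_integral => w _; under eq_integral do rewrite /= EFinM.
  rewrite ge0_integralZl//.
  + apply/measurable_EFinP; apply: (measurableT_comp mK).
    exact: measurable_funD.
  + by move=> u _; rewrite lee_fin.
  + by rewrite lee_fin.
- apply/measurable_EFinP; apply: measurable_funM => //.
  exact: measurableT_comp.
- by move=> z; rewrite lee_fin mulr_ge0.
Qed.

Lemma move_time_ge0 : {ae P, forall w, forall n, 0 <= S n w}.
Proof.
apply: filterS wait_ge0 => w w0 n; elim: n => [|n IH]; first by rewrite move_time0.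
by rewrite move_timeS addr_ge0.
Qed.

Lemma probability_wait_le (t : R) : 0 <= t -> forall n,
  P (tau n @^-1` `]-oo, t]) = (1 - expR (- lambda * t))%:E.
Proof.
move=> t0 n.
suff tail : P (tau n @^-1` `]t, +oo[) = (expR (- lambda * t))%:E.
  rewrite EFinB -tail -probability_setC.
    by rewrite preimage_setC setCitvr.
  exact: measurable_preimage_wait.
rewrite [LHS](tau_exp n (measurable_itv _)) -integral_expR_tail//.
rewrite -[RHS]integral_itv_obnd_cbnd; last first.
  apply/measurable_EFinP; apply: measurable_funTS.
  by apply: measurable_funM => //; apply: measurableT_comp.
apply: eq_integral => u; rewrite inE/= in_itv/= andbT => tu.
by rewrite exponential_pdfE// (le_trans t0)// ltW.
Qed.

(** Almost surely the waiting times are nonnegative, so [S n <= t] forces each of the first [n] of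
    them to be at most [t]; independence then gives a power. This geometric bound is enough to make
    the probability tend to 0. *)
Lemma probability_move_time_le (t : R) n : 0 <= t ->
  (P [set w | (S n w <= t)%R] <= ((1 - expR (- lambda * t)) ^+ n)%:E)%E.
Proof.
move=> t0; pose C := `]-oo, t]%classic : set R.
have past_all m : past_waits m (\bigcap_(i in `I_m) tau i @^-1` C).
  by exists (fun=> C) => // i; exact: measurable_itv.
have <- : P (\bigcap_(i in `I_n) tau i @^-1` C) =
    ((1 - expR (- lambda * t)) ^+ n)%:E.
  elim: n => [|n IH]; first by rewrite II0 bigcap_set0 probability_setT.
  rewrite exprSr EFinM -IH -(probability_wait_le t0 n) -past_waits_indep//.
    congr (P _); apply/seteqP; split=> [w Cw|w [Cw Cnw] i /=].
      by split=> [i /= ilt|]; apply: Cw => /=; rewrite ?ltnS// ltnW.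
    by rewrite ltnS leq_eqVlt => /predU1P[->|]; [exact: Cnw|exact: Cw].
  exact: sub_sigma_algebra.
have [N [mN PN subN]] := wait_ge0.
have mB : measurable (\bigcap_(i in `I_n) tau i @^-1` C).
  exact: past_waits_measurable (past_all n).
rewrite -[leRHS]adde0 -PN.
apply: (@le_trans _ _ (P ((\bigcap_(i in `I_n) tau i @^-1` C) `|` N))); last first.
  exact: measureU2.
apply: le_measure.
- rewrite inE -[X in measurable X]setTI; apply: measurable_fun_ler => //.
  exact: measurable_move_time.
- by rewrite inE; exact: measurableU.
move=> w /= Swt; have [w0|/subN Nw] := pselect (forall i, 0 <= tau i w); last by right.
left=> i /= iltn; rewrite /C /= in_itv/=; apply: le_trans Swt.
rewrite /move_time (bigD1 (Ordinal iltn))//= lerDl.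
by apply: sumr_ge0 => j _.
Qed.

End waiting_times.

(** * Expected product of the thinning factors along the move times *)

Section thinned_walk.
Context (R : realType) (d : measure_display) (Omega : measurableType d)
  (P : probability Omega R).
Variables (tau : nat -> {RV P >-> R}) (lambda : R).
Hypothesis lambda_gt0 : 0 < lambda.
Hypothesis tau_exp : forall i (B : set R), measurable B ->
  distribution P (tau i) B = exponential_prob lambda B.
Hypothesis tau_indep : mutually_independent tau.
Variables (a : nat -> R) (T : nat).
Hypothesis a01 : forall k, 0 <= a k <= 1.

Local Notation S := (move_time tau).
Local Notation phi := (thinning a T).
Local Notation G := (survival lambda a T).

Definition thinning_upto (n : nat) (w : Omega) : R :=
  \prod_(1 <= i < n.+1) phi (S i w).

Lemma thinning_upto_ge0 n w : 0 <= thinning_upto n w.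
Proof. by apply: prodr_ge0 => i _; exact: thinning_ge0. Qed.

Lemma thinning_upto_le1 n w : thinning_upto n w <= 1.
Proof.
by apply: Num.Theory.prodr_ile1 => i _; rewrite thinning_ge0// thinning_le1.
Qed.

Lemma measurable_past_thinning_upto n :
  measurable_fun [set: g_sigma_algebraType (past_waits tau n)] (thinning_upto n).
Proof.
(* The guard makes the factor measurable with respect to the past at every index, including those
   beyond [n], where [S i] involves later waiting times. *)
have -> : thinning_upto n = fun w =>
    \prod_(1 <= i < n.+1) (if (i <= n)%N then phi (S i w) else 1).
  apply/funext => w; rewrite /thinning_upto.
  by apply: eq_big_nat => i /andP[_ iln]; rewrite ifT.
apply: measurable_prod => i _; case: leqP => // iln.
apply: (measurableT_comp (@measurable_thinning _ a T)).
exact: measurable_past_move_time.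
Qed.

Lemma measurable_thinning_upto n : measurable_fun [set: Omega] (thinning_upto n).
Proof.
apply: measurable_prod => i _; apply: (measurableT_comp (@measurable_thinning _ a T)).
exact: measurable_move_time.
Qed.

(** Integrating out the last waiting time turns the factor [phi * G] at move [n.+1] into [G] at move
    [n], by the fixed-point property, so the expectation does not depend on [n]. *)
Lemma integral_thinning_upto_survival n :
  (\int[P]_w (thinning_upto n w * G (S n w))%:E = (G 0)%:E)%E.
Proof.
have mK : measurable_fun [set: R] (fun s => phi s * G s).
  by apply: measurable_funM; [exact: measurable_thinning|exact: measurable_survival].
have mGS i : measurable_fun [set: Omega] (fun w => G (S i w)).
  apply: (measurableT_comp (@measurable_survival _ lambda a T)).
  exact: measurable_move_time.
elim: n => [|n IH].
  under eq_integral do rewrite /thinning_upto big_geq// mul1r move_time0.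
  by rewrite integral_cst// [X in (_ * X)%E](probability_setT P) mule1.
under eq_integral do rewrite /thinning_upto big_nat_recr//= -/(thinning_upto n _) -mulrA.
rewrite (integral_move_timeS tau_indep (Z := thinning_upto n)
  (K := fun s => phi s * G s))//; last 3 first.
- exact: measurable_past_thinning_upto.
- exact: thinning_upto_ge0.
- by move=> s; rewrite mulr_ge0 ?thinning_ge0 ?survival_ge0.
have K0 s : (0 <= (phi s * G s)%:E)%E.
  by rewrite lee_fin mulr_ge0 ?thinning_ge0 ?survival_ge0.
rewrite -{}IH; apply: ge0_ae_eq_integral => //.
- apply: emeasurable_funM.
    by apply/measurable_EFinP; exact: measurable_thinning_upto.
  have mF := @measurable_fun_fubini_tonelli_F _ _ (measurableTypeR R)
    (measurableTypeR R) R (distribution P (waitR tau n))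
    (fun z => (phi (z.1 + z.2) * G (z.1 + z.2))%:E).
  apply: (measurableT_comp (mF _ _)) => //.
    apply/measurable_EFinP; apply: (measurableT_comp mK).
    exact: measurable_funD.
  exact: (measurable_move_time tau n).
- by apply/measurable_EFinP/measurable_funM => //; exact: measurable_thinning_upto.
- move=> w _; rewrite mule_ge0// ?lee_fin ?thinning_upto_ge0//.
  by apply: integral_ge0 => u _; exact: K0.
- by move=> w _; rewrite lee_fin mulr_ge0 ?thinning_upto_ge0 ?survival_ge0.
apply: filterS (move_time_ge0 tau_exp) => w S0 _.
rewrite (integral_thinning_survival T lambda_gt0 a01)// ?EFinM//.
by move=> B; exact: tau_exp.
Qed.

(** A squeeze between [G 0] and [G 0 + p ^+ n]. The lower bound holds since [G] is at most 1. For
    the upper one, the factor [G (S n)] can be inserted at no cost when [S n] exceeds [T], and the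
    complementary event has probability at most [p ^+ n]. *)
Lemma cvg_integral_thinning_upto :
  (\int[P]_w (thinning_upto n w)%:E)%E @[n --> \oo] --> (G 0)%:E.
Proof.
pose p : R := 1 - expR (- lambda * T%:R).
have p0 : 0 <= p by rewrite subr_ge0 -expR0 ler_expR mulNr oppr_le0 mulr_ge0// ltW.
have p1 : p < 1 by rewrite ltrBlDr ltrDl expR_gt0.
have mGS i : measurable_fun [set: Omega] (fun w => G (S i w)).
  apply: (measurableT_comp (@measurable_survival _ lambda a T)).
  exact: measurable_move_time.
have mY := measurable_thinning_upto.
apply: (@squeeze_cvge _ _ _ _ (fun=> (G 0)%:E) _ (fun n => ((G 0)%:E + (p ^+ n)%:E)%E)).
- apply: nearW => n; apply/andP; split.
    rewrite -(integral_thinning_upto_survival n); apply: ge0_le_integral => //.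
    + by move=> w _; rewrite lee_fin mulr_ge0 ?thinning_upto_ge0 ?survival_ge0.
    + by apply/measurable_EFinP/measurable_funM.
    + exact/measurable_EFinP.
    + move=> w _; rewrite lee_fin ler_piMr ?thinning_upto_ge0//.
      exact: survival_le1.
  pose D := [set w | (S n w <= T%:R)%R].
  have mD : measurable D.
    rewrite -[X in measurable X]setTI; apply: measurable_fun_ler => //.
    exact: measurable_move_time.
  have := probability_move_time_le lambda_gt0 tau_exp tau_indep n (ler0n R T).
  rewrite -/D -/p => /(leeD2l (G 0)%:E); apply: le_trans.
  rewrite -(integral_thinning_upto_survival n) -(setIT D) -integral_indic//.
  rewrite -ge0_integralD//; last 3 first.
    + by move=> w _; rewrite lee_fin mulr_ge0 ?thinning_upto_ge0 ?survival_ge0.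
    + by apply/measurable_EFinP/measurable_funM.
    + exact/measurable_EFinP.
  apply: ge0_le_integral => //.
    + by move=> w _; rewrite lee_fin thinning_upto_ge0.
    + exact/measurable_EFinP.
    + apply: emeasurable_funD; apply/measurable_EFinP => //.
      exact: measurable_funM.
  move=> w _; rewrite -EFinD lee_fin indicE.
  have [wD|] := boolP (w \in D).
    rewrite (le_trans (thinning_upto_le1 _ _))// lerDr mulr_ge0 ?survival_ge0//.
    exact: thinning_upto_ge0.
  rewrite notin_setE /D /= => /negP; rewrite -ltNge => /ltW TS.
  by rewrite survival_end// mulr1 addr0.
- exact: cvg_cst.
- rewrite -[X in _ --> X]adde0; apply: cvgeD => //; first exact: cvg_cst.
  apply: cvg_EFin; first exact: nearW.
  by apply: cvg_expr; rewrite ger0_norm.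
Qed.

End thinned_walk.

Lemma measurable_fun_nat2 d (T : measurableType d) (R : realType)
    (K L : T -> nat) (g : nat -> nat -> R) :
    measurable_fun [set: T] K -> measurable_fun [set: T] L ->
  measurable_fun [set: T] (fun w => g (K w) (L w)).
Proof.
move=> mK mL _ B _; rewrite setTI.
rewrite (_ : _ @^-1` B = \bigcup_k \bigcup_(x in [set x | B (g k x)])
    (K @^-1` [set k] `&` L @^-1` [set x])); last first.
  apply/seteqP; split=> [w Bw|w [k _ [x Bx [Kw Lw]]]] /=; last by rewrite Kw Lw.
  by exists (K w) => //; exists (L w).
apply: bigcup_measurable => k _; apply: bigcup_measurable => x _.
by apply: measurableI; rewrite -[X in measurable X]setTI; [exact: mK|exact: mL].
Qed.

(** * The walk *)

Definition hit_prob (R : realType) (k0 v k : nat) : R :=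
  if (0 < v <= k0 + k)%N then (k0 + k - 1)%N%:R^-1 else 0.

Section hit_prob.
Variables (R : realType) (k0 : nat).
Hypothesis hk0 : (3 <= k0)%N.

Lemma hit_prob01 v k : 0 <= hit_prob R k0 v k <= 1.
Proof.
rewrite /hit_prob; case: ifP => _; last by rewrite lexx ler01.
by rewrite invr_ge0 ler0n/= invf_le1 ?ler1n ?ltr0n; lia.
Qed.

Lemma jump_prob_ge0 (s : R) x y : 0 <= jump_prob k0 s x y.
Proof. by rewrite /jump_prob; case: ifP => // _; rewrite invr_ge0. Qed.

Lemma jump_prob_absent (s : R) x y : y \notin present k0 s -> jump_prob k0 s x y = 0.
Proof.
by move=> ys; rewrite /jump_prob /neighbours mem_filter (negbTE ys) andbF.
Qed.

(** Removing [x] from the present vertices leaves [k0 + truncn s - 1] of them wherever the walker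
    is; this makes the chance of hitting [v] independent of the past positions. *)
Lemma jump_prob_hit (s : R) x v : x \in present k0 s -> x != v ->
  jump_prob k0 s x v = hit_prob R k0 v (Num.truncn s).
Proof.
move=> xs xv; rewrite /jump_prob /hit_prob mem_filter eq_sym xv/=.
rewrite mem_iota add1n ltnS; case: ifP => // _; congr (_%:R^-1).
rewrite size_filter -(size_iota 1 (k0 + Num.truncn s)) -[iota _ _]/(present k0 s).
rewrite -(count_predC (pred1 x) (present k0 s)) count_uniq_mem ?iota_uniq// xs.
by rewrite addKn.
Qed.

Lemma present_mono (s t : R) x : s <= t -> x \in present k0 s -> x \in present k0 t.
Proof. by move=> /le_truncn st; rewrite !mem_iota; lia. Qed.

End hit_prob.

(** * Conditioning on the history of the walk *)

Section growing_walk_theory.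
Context (R : realType) (d : measure_display) (Omega : measurableType d)
  (P : probability Omega R).
Variables (lambda : R) (k0 : nat) (tau : nat -> {RV P >-> R})
  (X : nat -> {RV P >-> nat}).
Hypotheses (hk0 : (3 <= k0)%N) (lambda_gt0 : 0 < lambda)
  (hwalk : growing_walk lambda k0 tau X).

Local Notation S := (move_time tau).
Local Notation history := (history tau X).
Local Notation HT n := (g_sigma_algebraType (history n)).

Let tau_exp := walk_wait_exp hwalk.
Let tau_indep := walk_wait_indep hwalk.

(** [history n] is already a sigma-algebra, so generating once more, as the type [HT n] does, adds
    nothing. *)
Lemma history_sigma n A : <<s history n>> A -> history n A.
Proof. by rewrite sigma_algebra_id//; exact: smallest_sigma_algebra. Qed.

Lemma history_measurable n : history n `<=` measurable.
Proof.
apply: smallest_sub; first exact: sigma_algebra_measurable.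
move=> _ [[i [B [mB ->]]]|[j [x [_ ->]]]];
  by rewrite -[X in measurable X]setTI; exact: measurable_funP.
Qed.

Lemma measurable_history_wait n i : measurable_fun [set: HT n] (tau i).
Proof.
move=> _ B mB; rewrite setTI; do 2 apply: sub_sigma_algebra.
by left; exists i, B.
Qed.

Lemma measurable_history_pos n i : (i <= n)%N -> measurable_fun [set: HT n] (X i).
Proof.
move=> ilen _ Y _; rewrite setTI.
rewrite (_ : X i @^-1` Y = \bigcup_(y in Y) X i @^-1` [set y]).
  apply: bigcup_measurable => y _; do 2 apply: sub_sigma_algebra.
  by right; exists i, y.
apply/seteqP; split=> [w Yw|w [y Yy Xw]]; first by exists (X i w).
by rewrite /preimage/= Xw.
Qed.

Lemma measurable_history_move_time n i : measurable_fun [set: HT n] (S i).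
Proof. by apply: measurable_sum => j; exact: measurable_history_wait. Qed.

Lemma measurable_preimage_pos n y : measurable (X n @^-1` [set y]).
Proof. by rewrite -[X in measurable X]setTI; exact: measurable_funP. Qed.

Lemma measurable_history_jump n y :
  measurable_fun [set: HT n] (fun w => jump_prob k0 (S n.+1 w) (X n w) y).
Proof.
(* The jump probability depends only on two natural numbers, the truncated move time and the
   position, so measurability reduces to theirs. *)
pose g k x : R := if y \in [seq z <- iota 1 (k0 + k) | z != x] then
    (size [seq z <- iota 1 (k0 + k) | z != x])%:R^-1 else 0.
  apply: (@measurable_fun_nat2 _ (HT n) _ (fun w => Num.truncn (S n.+1 w))
  (X n) g); last exact: measurable_history_pos.
apply: (measurableT_comp (@measurable_truncn R)).
  exact: measurable_history_move_time.
Qed.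

Lemma integral_jump n y (f : HT n -> \bar R) :
    (forall w, 0 <= f w)%E -> measurable_fun [set: _] f ->
  (\int[P]_w (f w * (\1_(X n.+1 @^-1` [set y]) w)%:E) =
   \int[P]_w (f w * (jump_prob k0 (S n.+1 w) (X n w) y)%:E))%E.
Proof.
move=> f0 mf; apply: ge0_integral_density_sub => //.
- exact: history_measurable.
- exact: measurable_preimage_pos.
- by move=> w; exact: jump_prob_ge0.
- exact: measurable_history_jump.
- by move=> A /history_sigma hA; exact: (walk_jump hwalk).
Qed.

(** Absence of a vertex [y] at move [n.+1] is an event of [history n], on which the jump probability
    to [y] is 0; the exceptional set is a countable union of such null events. *)
Lemma pos_present : {ae P, forall w, forall n, X n w \in present k0 (S n w)}.
Proof.
apply: ae_foralln => -[|n].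
  have [x0 x0p X0] := walk_start hwalk.
  by apply: aeW => w; rewrite X0 move_time0.
pose A y := [set w | y \notin present k0 (S n.+1 w)].
have hA y : <<s history n>> (A y).
  have mK : measurable_fun [set: HT n] (fun w => Num.truncn (S n.+1 w)).
    apply: (measurableT_comp (@measurable_truncn R)).
    exact: measurable_history_move_time.
  have := mK measurableT [set k | y \notin iota 1 (k0 + k)].
  by rewrite setTI; apply.
exists (\bigcup_y (A y `&` X n.+1 @^-1` [set y])).
have mAX y : measurable (A y `&` X n.+1 @^-1` [set y]).
  apply: measurableI; last exact: measurable_preimage_pos.
  exact: history_measurable (history_sigma (hA y)).
have mU : measurable (\bigcup_y (A y `&` X n.+1 @^-1` [set y])).
  by apply: bigcup_measurable => y _.
split=> //.
- apply/negligibleP => //.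
  apply: negligible_bigcup => y; apply/negligibleP; first exact: mAX.
  rewrite [LHS](walk_jump hwalk y (history_sigma (hA y))).
  by apply: integral0_eq => w /jump_prob_absent ->.
- by move=> w /= /negP Xw; exists (X n.+1 w).
Qed.


(** * Probability that a given vertex stays unvisited *)

Section unvisited.
Variables (T v : nat).

Local Notation a := (hit_prob R k0 v).
Local Notation phi := (thinning a T).

(** These events belong to [history n] and decrease, as [n] grows, to the event that [v] is not
    visited by time [T]. *)
Definition avoids (n : nat) : set Omega :=
  [set w | forall i, (i <= n)%N -> S i w <= T%:R -> X i w <> v].

Lemma avoidsS n :
  avoids n.+1 = avoids n `\` ([set w | S n.+1 w <= T%:R] `&` X n.+1 @^-1` [set v]).
Proof.
apply/seteqP; split=> [w An|w [An nD] i].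
  split=> [i ilen|/= [ST Xv]]; first exact/An/leqW.
  exact: An Xv.
rewrite leq_eqVlt ltnS => /predU1P[->|]; last exact: An.
by move=> ST Xv; apply: nD.
Qed.

Lemma measurable_history_le n i :
  @measurable _ (HT n) [set w | S i w <= T%:R].
Proof.
rewrite -[X in measurable X]setTI; apply: measurable_fun_ler => //.
exact: measurable_history_move_time.
Qed.

Lemma measurable_history_avoids n i : (i <= n)%N ->
  @measurable _ (HT n) (avoids i).
Proof.
have mXv j : (j <= n)%N -> @measurable _ (HT n) (X j @^-1` [set v]).
  move=> jn; rewrite -[X in measurable X]setTI.
  exact: (measurable_history_pos jn).
elim: i => [|i IH] ilen.
  rewrite (_ : avoids 0 = ~` ([set w | S 0 w <= T%:R] `&` X 0%N @^-1` [set v])).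
    apply: measurableC; apply: measurableI; last exact: mXv.
    exact: measurable_history_le.
  apply/seteqP; split=> [w A0 [S0 X0]|w nX j]; first exact: (A0 0%N).
  by rewrite leqn0 => /eqP -> S0 X0; apply: nX.
rewrite avoidsS; apply: measurableD; first exact: IH (ltnW ilen).
by apply: measurableI; [exact: measurable_history_le|exact: mXv].
Qed.

(** Conditionally on [history n] and on having avoided [v] so far, move [n.+1] visits [v] by time
    [T] with probability [a] at that time if the move is made by [T], and with probability 0
    otherwise; it thus keeps avoiding [v] with probability [phi (S n.+1 w)]. *)
Lemma integral_avoidsS n (f : HT n -> R) :
    measurable_fun [set: _] f -> (forall w, 0 <= f w <= 1) ->
  (\int[P]_w (f w * \1_(avoids n.+1) w)%:E =
   \int[P]_w (f w * phi (S n.+1 w) * \1_(avoids n) w)%:E)%E.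
Proof.
move=> mf f01.
have f0 w : 0 <= f w by case/andP: (f01 w).
pose C : set Omega := [set w | S n.+1 w <= T%:R].
pose D := X n.+1 @^-1` [set v].
(* The test function cut down to the event that [v] is still avoided and that move [n.+1] is made by
   time [T]; it is measurable for [history n]. *)
pose c : HT n -> R := fun w => f w * \1_(avoids n) w * \1_C w.
have c0 w : 0 <= c w by rewrite !mulr_ge0.
have mA : @measurable _ (HT n) (avoids n) by exact: measurable_history_avoids.
have mC : @measurable _ (HT n) C by exact: measurable_history_le.
have mc : measurable_fun [set: HT n] c.
  by apply: measurable_funM; [apply: measurable_funM => //|];
    exact: measurable_indic.
have hmeas (g : HT n -> R) : measurable_fun [set: HT n] g ->
    measurable_fun [set: Omega] (g : Omega -> R).
  move=> mg _ Y mY.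
  exact: history_measurable (history_sigma (mg measurableT Y mY)).
have mphi : measurable_fun [set: HT n] (fun w => phi (S n.+1 w)).
  apply: (measurableT_comp (@measurable_thinning _ a T)).
  exact: measurable_history_move_time.
have mhit : measurable_fun [set: HT n] (fun w => a (Num.truncn (S n.+1 w))).
  apply: (measurableT_comp (f := a)) => //.
  apply: (measurableT_comp (@measurable_truncn R)).
  exact: measurable_history_move_time.
have a01 := hit_prob01 R hk0 v.
have mAO i : measurable (avoids i).
  have mAi : @measurable _ (HT i) (avoids i) by exact: measurable_history_avoids.
  exact: history_measurable (history_sigma mAi).
have mD : measurable D by exact: measurable_preimage_pos.
have jump_hit : (\int[P]_w (c w * \1_D w)%:E =
    \int[P]_w (c w * a (Num.truncn (S n.+1 w)))%:E)%E.
  under eq_integral do rewrite EFinM.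
  rewrite (@integral_jump n v (EFin \o c))//; last exact/measurable_EFinP.
  under [RHS]eq_integral do rewrite EFinM.
  apply: ge0_ae_eq_integral => //.
  - apply: emeasurable_funM; apply/measurable_EFinP; first exact: hmeas.
    by apply: hmeas; exact: measurable_history_jump.
  - apply: emeasurable_funM; apply/measurable_EFinP; exact: hmeas.
  - by move=> w _; rewrite mule_ge0// lee_fin// jump_prob_ge0.
  - by move=> w _; rewrite mule_ge0// lee_fin; case/andP: (a01 (Num.truncn (S n.+1 w))).
  (* Where [c] does not vanish, move [n] is also made by time [T], so the walker sits at a present
     vertex other than [v] and [jump_prob_hit] applies. *)
  apply: filterS2 (wait_ge0 tau_exp) pos_present => w w0 Xw _ /=.
  rewrite /c !indicE; have [wC|] := boolP (w \in C); last by rewrite mulr0 !mul0e.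
  have [wA|] := boolP (w \in avoids n); last by rewrite mulr0 mul0r !mul0e.
  have SS : S n w <= S n.+1 w by rewrite move_timeS lerDl.
  rewrite jump_prob_hit//; first exact: present_mono (Xw n).
  move: wA wC; rewrite !inE => /(_ n (leqnn n)) An Cw.
  exact/eqP/An/(le_trans SS).
have cfin : (\int[P]_w (c w * \1_D w)%:E)%E \is a fin_num.
  rewrite ge0_fin_numE; last first.
    by apply: integral_ge0 => w _; rewrite lee_fin mulr_ge0.
  apply: (@le_lt_trans _ _ (\int[P]_w (cst 1 w))%E); last first.
    by rewrite integral_cst// mul1e [ltLHS](probability_setT P) ltry.
  apply: ge0_le_integral => //.
  - by move=> w _; rewrite lee_fin mulr_ge0.
  - by apply/measurable_EFinP/measurable_funM; [exact: hmeas|exact: measurable_indic].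
  - move=> w _; rewrite lee_fin /c.
    have i1 (B : set Omega) : (\1_B w : R) <= 1.
      by rewrite indicE; case: (_ \in _).
    do 3 (apply: mulr_ile1; [by rewrite ?mulr_ge0| by [] | |exact: i1]).
    by case/andP: (f01 w).
(* The finite mass of the paths that hit [v] at move [n.+1] is added to both sides. Each side then
   becomes the integral of [f] over [avoids n], and the integrands agree pointwise. *)
rewrite -[LHS](addeK _ cfin) -[RHS](addeK _ cfin); congr (_ - _)%E.
rewrite [in RHS]jump_hit.
rewrite -ge0_integralD//; last 4 first.
- by move=> w _; rewrite lee_fin mulr_ge0.
- apply/measurable_EFinP/measurable_funM; last exact: measurable_indic.
  exact: hmeas.
- by move=> w _; rewrite lee_fin mulr_ge0.
- apply/measurable_EFinP/measurable_funM; last exact: measurable_indic.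
  exact: hmeas.
rewrite -ge0_integralD//; last 4 first.
- by move=> w _; rewrite lee_fin !mulr_ge0// thinning_ge0.
- apply/measurable_EFinP/measurable_funM; last exact: measurable_indic.
  by apply: hmeas; exact: measurable_funM.
- by move=> w _; rewrite lee_fin mulr_ge0//; case/andP: (a01 (Num.truncn (S n.+1 w))).
- by apply/measurable_EFinP/measurable_funM; exact: hmeas.
apply: eq_integral => w _; rewrite -!EFinD; congr EFin.
rewrite /c avoidsS -/C -/D !indicE in_setD in_setI /thinning.
have -> : (S n.+1 w <= T%:R) = (w \in C) by apply/idP/idP; rewrite inE.
by case: (w \in avoids n) (w \in C) (w \in D) => [] [] [] /=; ring.
Qed.

Variable x0 : nat.
Hypothesis X0 : forall w, X 0%N w = x0.

Lemma avoids0 : avoids 0 = if x0 == v then set0 else setT.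
Proof.
case: eqP => x0v; apply/seteqP; split=> // w.
  by move=> /(_ 0%N (leqnn 0)); rewrite move_time0 X0; exact.
by move=> _ i; rewrite leqn0 => /eqP -> _; rewrite X0.
Qed.

(* [history n] contains all the waiting times, also those after move [n]; this is
   what lets the factor [phi (S n.+1 w)] be absorbed into the test function. *)
Lemma integral_avoids n (f : Omega -> R) :
    (forall m, measurable_fun [set: HT m] f) -> (forall w, 0 <= f w <= 1) ->
  (\int[P]_w (f w * \1_(avoids n) w)%:E =
   \int[P]_w ((x0 != v)%:R * (f w * thinning_upto tau a T n w))%:E)%E.
Proof.
elim: n f => [|n IH] f mf f01.
  apply: eq_integral => w _; rewrite avoids0 /thinning_upto big_geq// mulr1 mulrC.
  by case: eqP => _; rewrite ?indic0 ?indicT.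
have phi01 w : 0 <= phi (S n.+1 w) <= 1.
  by rewrite thinning_ge0 ?thinning_le1// => k; exact: hit_prob01.
rewrite (integral_avoidsS (mf n) f01) IH.
- apply: eq_integral => w _; congr (_ * _)%:E.
  by rewrite /thinning_upto [in RHS]big_nat_recr//= [RHS]mulrA mulrAC.
- move=> m; apply: measurable_funM => //.
  apply: (measurableT_comp (@measurable_thinning _ a T)).
  exact: measurable_history_move_time.
- move=> w; have /andP[f0 f1] := f01 w; have /andP[p0 p1] := phi01 w.
  by rewrite mulr_ge0//= mulr_ile1.
Qed.

Lemma measurable_avoids n : measurable (avoids n).
Proof.
have mAn : @measurable _ (HT n) (avoids n) by exact: measurable_history_avoids.
exact: history_measurable (history_sigma mAn).
Qed.

Lemma unvisitedE : ~` [set w | visited tau X T w v] = \bigcap_n avoids n.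
Proof.
apply/seteqP; split=> [w nv n _ i _ ST Xv|w Aw [n [ST Xv]]].
  by apply: nv; exists i.
by apply: (Aw n _ n) => //.
Qed.

(** Continuity from above along [avoids n], whose probabilities are expected products of thinning
    factors by [integral_avoids] with test function 1. *)
Lemma probability_unvisited :
  P (~` [set w | visited tau X T w v]) =
  ((x0 != v)%:R * expR (- (lambda * \sum_(0 <= k < T) a k)))%:E.
Proof.
have a01 := hit_prob01 R hk0 v.
rewrite unvisitedE; have PA n : P (avoids n) =
    ((x0 != v)%:R%:E * \int[P]_w (thinning_upto tau a T n w)%:E)%E.
  have := @integral_avoids n (cst 1).
  under eq_integral do rewrite mul1r.
  rewrite integral_indic//; last exact: measurable_avoids.
  rewrite setIT => ->//; last by move=> w; rewrite ler01 lexx.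
  under eq_integral do rewrite mul1r EFinM.
  rewrite ge0_integralZl//.
  + by apply/measurable_EFinP; exact: measurable_thinning_upto.
  + by move=> w _; rewrite lee_fin thinning_upto_ge0.
have : P (avoids n) @[n --> \oo] --> P (\bigcap_n avoids n).
  apply: nonincreasing_cvg_mu.
  - by rewrite -ge0_fin_numE// fin_num_measure//; exact: measurable_avoids.
  - exact: measurable_avoids.
  - by apply: bigcapT_measurable => n; exact: measurable_avoids.
  - by move=> m n mn; apply/subsetPset => w An i im; exact/An/(leq_trans im).
have : P (avoids n) @[n --> \oo] -->
    ((x0 != v)%:R * expR (- (lambda * \sum_(0 <= k < T) a k)))%:E.
  under eq_fun do rewrite PA.
  rewrite EFinM -survival0; apply: cvgeZl => //.
  exact: cvg_integral_thinning_upto.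
by move=> h1 h2; apply: (cvg_unique _ h2 h1).
Qed.

End unvisited.

End growing_walk_theory.

(** * Harmonic sums and the exact mean *)

Lemma harmonic_numberS (R : realType) n :
  harmonic_number R n.+1 = harmonic_number R n + n.+1%:R^-1.
Proof. by rewrite /harmonic_number big_nat_recr. Qed.

Lemma sum_hit_prob (R : realType) (k0 v T : nat) : (3 <= k0)%N ->
    (0 < v < k0 + T)%N -> (0 < T)%N ->
  \sum_(0 <= k < T) hit_prob R k0 v k =
  harmonic_number R (k0 + T - 2) - harmonic_number R (maxn k0 v - 2).
Proof.
move=> hk0 /andP[v0 vT] T0.
(* With truncated subtraction, [v - k0] is the time at which [v] appears: the terms before it
   vanish, and each further unit of time adds one reciprocal. *)
have [j TE] : exists j, T = (v - k0 + j)%N by exists (T - (v - k0))%N; lia.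
have maxE : (maxn k0 v - 2 = k0 + (v - k0) - 2)%N by lia.
rewrite {T vT T0}TE maxE; elim: j => [|j IH].
  rewrite addn0 subrr big_nat big1// => k /andP[_ kv].
  by rewrite /hit_prob ifF//; lia.
rewrite addnS big_nat_recr//= IH /hit_prob ifT; last by lia.
have -> : (k0 + (v - k0 + j).+1 - 2 = (k0 + (v - k0 + j) - 2).+1)%N by lia.
rewrite harmonic_numberS.
have -> : (k0 + (v - k0 + j) - 1 = (k0 + (v - k0 + j) - 2).+1)%N by lia.
by ring.
Qed.

Section mean.
Context (R : realType) (d : measure_display) (Omega : measurableType d)
  (P : probability Omega R).
Variables (lambda : R) (k0 : nat) (tau : nat -> {RV P >-> R})
  (X : nat -> {RV P >-> nat}).
Hypotheses (hk0 : (3 <= k0)%N) (lambda_gt0 : 0 < lambda)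
  (hwalk : growing_walk lambda k0 tau X).

Local Notation H := (harmonic_number R).

Lemma measurable_visited T v : measurable [set w | visited tau X T w v].
Proof.
rewrite -[X in measurable X]setCK unvisitedE; apply: measurableC.
apply: bigcapT_measurable => n; exact: measurable_avoids.
Qed.

Lemma mean_visitedE T :
  mean_visited tau X T = (\sum_(v <oo) P [set w | visited tau X T w v])%E.
Proof.
pose V v := [set w | visited tau X T w v].
rewrite /mean_visited /num_visited.
transitivity (\int[P]_w (\sum_(v <oo) (\1_(V v) w)%:E))%E.
  apply: eq_integral => w _; rewrite counting_dirac.
  apply: eq_eseriesr => v _; rewrite diracE indicE.
  have [Vw|nVw] := pselect (visited tau X T w v); first by rewrite !mem_set.
  by rewrite !memNset.
rewrite integral_nneseries//; last first.
  move=> v; apply/measurable_EFinP/measurable_indic.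
  exact: measurable_visited.
apply: eq_eseriesr => v _; rewrite integral_indic ?setIT//.
exact: measurable_visited.
Qed.

Lemma mean_visited_formula T : (1 <= T)%N ->
  mean_visited tau X T =
  ((k0 + T - 1)%N%:R - expR (- (lambda * H (k0 + T - 2))) *
    ((k0 - 1)%N%:R * expR (lambda * H (k0 - 2))
     + \sum_(k0.+1 <= j < k0 + T) expR (lambda * H (j - 2))))%:E.
Proof.
move=> T1; have [x0 x0p X0] := walk_start hwalk.
have x0k : (0 < x0 <= k0)%N by move: x0p; rewrite mem_iota truncn0; lia.
pose q v : R := 1 - (x0 != v)%:R *
  expR (- (lambda * \sum_(0 <= k < T) hit_prob R k0 v k)).
have PV v : P [set w | visited tau X T w v] = (q v)%:E.
  rewrite -[X in P X]setCK probability_setC; last first.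
    by apply: measurableC; exact: measurable_visited.
  by rewrite (probability_unvisited hk0 lambda_gt0 hwalk T v X0) EFinB.
(* This covers the vertex [k0 + T], created only at time [T], and reduces the series to a finite
   sum. *)
have q_out v : ~~ (0 < v < k0 + T)%N -> q v = 0.
  move=> vout; rewrite /q big_nat big1.
    have -> : x0 != v by apply/eqP; lia.
    by rewrite mulr0 oppr0 expR0 mulr1 subrr.
  by move=> k kT; rewrite /hit_prob ifF//; lia.
rewrite mean_visitedE; under eq_eseriesr do rewrite PV.
rewrite (nneseries_split 0 (k0 + T)); last first.
  by move=> v _; rewrite -PV.
rewrite add0n eseries0 ?adde0; last first.
  by move=> v kTv _; rewrite q_out//; lia.
rewrite sumEFin; congr EFin.
rewrite big_ltn; last by lia.
rewrite q_out// add0r.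
(* The initial vertices share the term [H (k0 - 2)], and the start, being visited for sure, leaves
   [k0 - 1] copies of it; each later vertex [v] brings its own [H (v - 2)]. *)
rewrite (@big_cat_nat _ _ _ k0.+1)/=; [|by lia|by lia].
pose h := H (k0 + T - 2).
have qE v : (0 < v < k0 + T)%N ->
    q v = 1 - (x0 != v)%:R *
      (expR (- (lambda * h)) * expR (lambda * H (maxn k0 v - 2))).
  move=> vkT; rewrite /q sum_hit_prob// -expRD; congr (_ - _ * expR _).
  by rewrite /h; ring.
have -> : \sum_(1 <= v < k0.+1) q v =
    k0%:R - (k0 - 1)%N%:R * (expR (- (lambda * h)) * expR (lambda * H (k0 - 2))).
  have sum1 : \sum_(1 <= v < k0.+1) (x0 != v)%:R = (k0 - 1)%N%:R :> R.
    have x0I : x0 \in index_iota 1 k0.+1 by rewrite mem_index_iota; lia.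
    rewrite (bigD1_seq x0)//= ?iota_uniq// eqxx add0r.
    under eq_bigr => v vx0 do rewrite eq_sym vx0.
    have : \sum_(1 <= v < k0.+1) 1 = 1 + \sum_(1 <= v < k0.+1 | v != x0) 1 :> R.
      by rewrite (bigD1_seq x0)//= iota_uniq.
    rewrite sumr_const_nat subSS subn0 => k0E.
    by rewrite natrB ?k0E; [rewrite addrAC subrr add0r|lia].
  rewrite -sum1 big_distrl/= -[X in X%:R - _](subn0 k0) -subSS -sumr_const_nat -sumrB.
  rewrite big_nat [RHS]big_nat; apply: eq_bigr => v vk.
  by rewrite qE ?(maxn_idPl _)//; lia.
have -> : \sum_(k0.+1 <= v < k0 + T) q v =
    (T - 1)%N%:R - expR (- (lambda * h)) *
      \sum_(k0.+1 <= v < k0 + T) expR (lambda * H (v - 2)).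
  rewrite big_distrr/= (_ : (T - 1 = k0 + T - k0.+1)%N); last by lia.
  rewrite -sumr_const_nat -sumrB big_nat [RHS]big_nat; apply: eq_bigr => v vk.
  rewrite qE; last by lia.
  have -> : (x0 != v) by apply/eqP; lia.
  by rewrite (maxn_idPr _) ?mul1r//; lia.
rewrite -/h (_ : (k0 + T - 1 = k0 + (T - 1))%N) ?natrD; last by lia.
by ring.
Qed.

End mean.

(** * Linear growth of the mean *)

Section linear_growth.
Context {R : realType}.
Variables (lambda : R) (k0 : nat) (U : nat -> R).
Hypotheses (lambda_gt0 : 0 < lambda) (hk0 : (1 <= k0)%N).
Hypothesis U_rec : forall n,
  U n.+1 = expR (- (lambda / (k0 + n)%N%:R)) * (U n + 1).

(** The slope [1 / (1 + lambda)] is the one for which the terms of order 1 in the recursion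
    cancel. *)
Let D n : R := U n - (k0 + n)%N%:R / (1 + lambda).

Let expRN_bounds (x : R) : 0 <= x -> 1 - x <= expR (- x) <= 1 - x + x ^+ 2.
Proof.
move=> x0; rewrite expR_ge1Dx/= expRN.
have x1 : 0 < 1 + x by lra.
rewrite (le_trans (_ : _ <= (1 + x)^-1))//.
  by rewrite lef_pV2 ?posrE ?expR_gt0// expR_ge1Dx.
rewrite -[leLHS]mul1r ler_pdivrMr//.
(* The upper bound comes from [(1 + x) * (1 - x + x ^+ 2) = 1 + x ^+ 3]. *)
have : 0 <= x ^+ 3 by rewrite exprn_ge0.
by rewrite !exprS expr0; lra.
Qed.

Let D_step n : `|D n.+1| <= `|D n| + (lambda + 2 * lambda ^+ 2) / n.+1%:R.
Proof.
set m : R := (k0 + n)%N%:R.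
have m1 : n.+1%:R <= m by rewrite ler_nat; lia.
have n0 : 0 < n.+1%:R :> R by rewrite ltr0n.
have m0 : 0 < m := lt_le_trans n0 m1.
have m_ge1 : 1 <= m by rewrite (le_trans _ m1)// ler1n.
pose x := lambda / m.
have x0 : 0 <= x by rewrite divr_ge0// ltW.
have /andP[el eu] := expRN_bounds x0.
set e := expR (- x) in el eu.
pose r := e - (1 - x).
have r0 : 0 <= r by rewrite subr_ge0.
have rx : r <= x ^+ 2 by rewrite /r; lra.
have e1 : e <= 1 by rewrite -expR0 ler_expR oppr_le0.
have e0 : 0 <= e := expR_ge0 _.
have l0 : 0 < 1 + lambda by rewrite addr_gt0.
have l1 : 1 + lambda != 0 by rewrite gt_eqF.
(* The old error is contracted by [e]. The new error is at most [lambda / m + x ^+ 2 * (2 * m)] in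
   absolute value, which is the constant [lambda + 2 * lambda ^+ 2] over [m]. *)
have DE : D n.+1 = e * D n + (- (lambda / m) + r * (m / (1 + lambda) + 1)).
  rewrite /D U_rec -/m -/x -/e addnS -natr1 -/m /r /x.
  field.
  by rewrite l1 -natrD gt_eqF.
have eD : `|e * D n| <= `|D n|.
  by rewrite normrM (ger0_norm e0) ler_piMl.
rewrite DE; apply: (le_trans (ler_normD _ _)); apply: lerD => //.
apply: (@le_trans _ _ ((lambda + 2 * lambda ^+ 2) / m)); last first.
  rewrite ler_pM2l ?lef_pV2 ?posrE//.
  by rewrite addr_gt0// mulr_gt0// exprn_gt0.
apply: (le_trans (ler_normD _ _)).
rewrite normrN ger0_norm ?divr_ge0 ?(ltW lambda_gt0) ?(ltW m0)//.
have ml : 0 <= m / (1 + lambda) + 1.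
  by rewrite addr_ge0// divr_ge0 ?(ltW m0)//; lra.
rewrite ger0_norm ?mulr_ge0//.
have ml2 : m / (1 + lambda) + 1 <= 2 * m.
  have : m / (1 + lambda) <= m.
    by rewrite ler_pdivrMr// mulrDr mulr1 lerDl mulr_ge0// ltW.
  by lra.
rewrite [leRHS]mulrDl; apply: lerD => //.
apply: (@le_trans _ _ (x ^+ 2 * (2 * m))); first exact: ler_pM.
rewrite /x le_eqVlt; apply/orP; left; apply/eqP; field.
by rewrite -natrD gt_eqF.
Qed.

Lemma cvg_linear_growth :
  (((k0 + n)%N%:R - U n) / n.+1%:R) @[n --> \oo] --> lambda / (1 + lambda).
Proof.
pose K := lambda + 2 * lambda ^+ 2.
pose u : R^nat := fun n => n.+1%:R^-1.
have K0 : 0 <= K by rewrite addr_ge0 ?mulr_ge0 ?exprn_ge0 ?ltW.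
have u0 : u @ \oo --> 0 by exact: cvg_harmonic.
have D_bound n : `|D n| <= `|D 0| + K * series u n.
  elim: n => [|n IH]; first by rewrite seriesEnat/= big_geq// mulr0 addr0.
  apply: (le_trans (D_step n)).
  rewrite seriesSr mulrDr addrA lerD2r; exact: IH.
(* The errors add up to at most a constant plus [K] times a harmonic sum; divided by [n.+1], that
   sum is a Cesaro mean of a sequence tending to 0. *)
have DT : (D n / n.+1%:R) @[n --> \oo] --> 0.
  apply: norm_cvg0.
  apply: (@squeeze_cvgr _ _ _ _ (fun=> 0)
    (fun n => `|D 0| * u n + K * arithmetic_mean u n)).
  - apply: nearW => n; rewrite normr_ge0/= normrM normfV (ger0_norm (ler0n _ n.+1)).
    rewrite /arithmetic_mean/= ler_pdivrMr ?ltr0n//.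
    apply: (le_trans (D_bound n)).
    have -> : (`|D 0| * u n + K * (n.+1%:R^-1 * series u n.+1)) * n.+1%:R =
        `|D 0| + K * series u n.+1.
      by rewrite /u; field; rewrite gt_eqF.
    by rewrite lerD2l ler_wpM2l// seriesSr lerDl invr_ge0.
  - exact: cvg_cst.
  - rewrite -[X in _ --> X](_ : `|D 0| * 0 + K * 0 = 0); last by rewrite !mulr0 addr0.
    by apply: cvgD; apply: cvgM; [exact: cvg_cst|exact: u0|exact: cvg_cst|exact: cesaro].
rewrite (_ : (fun n => _) = (fun n =>
    lambda / (1 + lambda) * (1 + (k0%:R - 1) * u n) - D n / n.+1%:R)).
  rewrite -[X in _ --> X](_ :
    lambda / (1 + lambda) * (1 + (k0%:R - 1) * 0) - 0 = _); last first.
    by rewrite mulr0 addr0 mulr1 subr0.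
  apply: cvgB => //; apply: cvgM; first exact: cvg_cst.
  apply: cvgD; first exact: cvg_cst.
  by apply: cvgM => //; exact: cvg_cst.
apply/funext => n; rewrite /D /u natrD -natr1; field.
have l0 : 0 < 1 + lambda by rewrite addr_gt0.
by rewrite natr1 pnatr_eq0 [1 + lambda == 0]gt_eqF.
Qed.

End linear_growth.

(** * The exact mean and its asymptotic slope *)

Theorem theorem2p1 (R : realType) (d : measure_display)
    (Omega : measurableType d) (P : probability Omega R)
    (lambda : R) (k0 : nat)
    (tau : nat -> {RV P >-> R}) (X : nat -> {RV P >-> nat})
    (hk0 : (3 <= k0)%N) (hlambda : 0 < lambda)
    (hwalk : growing_walk lambda k0 tau X) :
  (forall T : nat, (1 <= T)%N ->
     mean_visited tau X T =
     ((k0 + T - 1)%N%:R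
      - expR (- (lambda * harmonic_number R (k0 + T - 2))) *
        ((k0 - 1)%N%:R * expR (lambda * harmonic_number R (k0 - 2))
         + \sum_(k0.+1 <= j < k0 + T)
             expR (lambda * harmonic_number R (j - 2))))%:E)
  /\ (fun T : nat => (mean_visited tau X T * (T%:R^-1)%:E)%E) @ \oo -->
     (lambda / (1 + lambda))%:E.
Proof.
have mean_eq := mean_visited_formula hk0 hlambda hwalk; split=> //.
(* [U n] is the expected number of unvisited vertices for [T = n.+1], among [k0 + n]; the shift
   leaves out [T = 0], which the formula does not cover. *)
pose U n : R := expR (- (lambda * harmonic_number R (k0 + n.+1 - 2))) *
  ((k0 - 1)%N%:R * expR (lambda * harmonic_number R (k0 - 2))
   + \sum_(k0.+1 <= j < k0 + n.+1) expR (lambda * harmonic_number R (j - 2))).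
have U_rec n : U n.+1 = expR (- (lambda / (k0 + n)%N%:R)) * (U n + 1).
  rewrite {1}/U (_ : k0 + n.+2 - 2 = (k0 + n.+1 - 2).+1)%N; last by lia.
  rewrite harmonic_numberS (_ : (k0 + n.+1 - 2).+1 = k0 + n)%N; last by lia.
  rewrite [(k0 + n.+2)%N]addnS big_nat_recr/=; last by lia.
  rewrite [lambda * (_ + _)]mulrDr opprD expRD addrA [expR _ * expR _]mulrC -mulrA.
  (* The summand of the newest vertex is the inverse of the previous prefactor, which yields the
     [+ 1]. *)
  by congr (_ * _); rewrite mulrDr -expRD addNr expR0.
rewrite -cvg_shiftS/=.
under eq_fun => n do rewrite mean_eq// -EFinM -/(U n) addnS subn1/=.
apply: cvg_EFin; first exact: nearW.
exact: (cvg_linear_growth hlambda (ltnW (ltnW hk0)) U_rec).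
Qed.
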